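(* For $n\ge 3$, consider the $(n+1)$-dimensional second-order cone $$\mathcal{L}=\{x=(x_0,\ldots,x_n)\in\mathbb{R}^{n+1}\mid x_0\ge 0,\ x_0^2\ge x_1^2+\cdots+x_n^2\}.$$ Then $\mathcal{L}$ is rank-one generated (ROG) as a hyperbolicity cone, i.e. there exist a homogeneous polynomial $p$ and $e\in\mathbb{R}^{n+1}$ with $p$ hyperbolic along $e$ such that $\mathcal{L}=\Lambda_+(p,e)$ is ROG with respect to $p$ and $e$; but none of the spectrahedral representations of $\mathcal{L}$ is ROG.
   Context: A homogeneous polynomial $p:\mathbb{R}^{N}\to\mathbb{R}$ of degree $d$ is hyperbolic along $e$ if $p(e)>0$ and for every $x$ the univariate polynomial $t\mapsto p(x-te)$ has only real roots. Its hyperbolicity cone is $\Lambda_+(p,e)=\{x\in\mathbb{R}^{N}\mid\text{all roots of }t\mapsto p(te-x)\text{ are nonnegative}\}$. For $x\in\Lambda_+(p,e)$, $\operatorname{rank}(x)$ is the number of nonzero roots, counted with multiplicity, of $t\mapsto p(te-x)$. A face of a closed convex cone $K$ is a nonempty convex cone $F\subseteq K$ such that $x,y\in K$, $x+y\in F$ imply $x,y\in F$; an extreme ray is a face of dimension $1$. A pointed hyperbolicity cone $\Lambda_+(p,e)$ (pointed: $K\cap(-K)=\{0\}$) is ROG with respect to $p$ and $e$ if each of its extreme rays is generated by an element of rank $1$. Let $\mathcal{S}^m$ be the space of $m\times m$ real symmetric matrices and $\mathcal{S}^m_+$ the positive semidefinite cone. A spectrahedral representation of a closed convex cone $K\subseteq\mathbb{R}^{n+1}$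 is a linear map $\mathcal{A}:\mathbb{R}^{n+1}\to\mathcal{S}^m$ (for some $m$), $\mathcal{A}(x)=x_0A_0+\cdots+x_nA_n$ with $A_i\in\mathcal{S}^m$, such that $K=\{x\in\mathbb{R}^{n+1}\mid\mathcal{A}(x)\in\mathcal{S}^m_+\}$. The representation is ROG if, whenever $x$ generates an extreme ray of $K$, the matrix $\mathcal{A}(x)$ has rank $1$. *)

(* Defs.v *)
From HB Require Import structures.
From mathcomp Require Import all_boot all_order all_algebra.
From mathcomp Require Import boolp classical_sets reals.
From mathcomp Require Import complex polyrcf.
From mathcomp Require Import mpoly.

Set Implicit Arguments.
Unset Strict Implicit.
Unset Printing Implicit Defensive.

Import Order.TTheory GRing.Theory Num.Theory.
Local Open Scope classical_set_scope.
Local Open Scope ring_scope.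

(* Vectors of R^N are row vectors ['rV[R]_N]; [x 0] is the coordinate function
   of [x], so [p.@[x 0]] is the value of the polynomial [p] at [x]. *)

Section ConvexCones.
Context {R : realType} {N : nat}.
Implicit Types (F K : set 'rV[R]_N) (x : 'rV[R]_N).

Definition convex_cone F : Prop :=
  (forall x y, F x -> F y -> F (x + y)) /\
  (forall (a : R) x, 0 <= a -> F x -> F (a *: x)).

Definition pointed K : Prop := K `&` [set x | K (- x)] = [set 0].

Definition is_face K F : Prop :=
  [/\ F !=set0, F `<=` K, convex_cone F &
      forall x y, K x -> K y -> F (x + y) -> F x /\ F y].

Definition is_linear_span F (U : {vspace 'rV[R]_N}) : Prop :=
  F `<=` [set` U] /\
  forall W : {vspace 'rV[R]_N}, F `<=` [set` W] -> (U <= W)%VS.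

(* The dimension of a convex cone is the dimension of its linear span; a face
   contains the origin as soon as the ambient cone does, so this agrees with
   the dimension of the affine hull. *)
Definition has_dim F (k : nat) : Prop :=
  exists2 U : {vspace 'rV[R]_N}, is_linear_span F U & \dim U = k.

Definition extreme_ray K F : Prop := is_face K F /\ has_dim F 1%N.

Definition ray x : set 'rV[R]_N := [set y | exists2 a : R, 0 <= a & y = a *: x].

Definition generates_extreme_ray K x : Prop := extreme_ray K (ray x).

End ConvexCones.

Section Hyperbolicity.
Context {R : realType} {N : nat}.
Implicit Types (p : {mpoly R[N]}) (e x a b : 'rV[R]_N).

(* The univariate polynomial t |-> p (a + t b). *)
Definition line_poly p a b : {poly R} :=
  mmap (@polyC R) (fun i => (a 0 i)%:P + b 0 i *: 'X) p.

Lemma horner_line_poly p a b (t : R) :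
  (line_poly p a b).[t] = p.@[(a + t *: b) 0].
Proof.
rewrite /line_poly /meval /mmap horner_sum; apply: eq_bigr => m _.
rewrite hornerM hornerC /mmap1 horner_prod; congr (_ * _).
by apply: eq_bigr => i _; rewrite horner_exp !hornerE !mxE [t * _]mulrC.
Qed.

(* "Only real roots" is said of the complex roots. *)
Definition real_rooted (q : {poly R}) : Prop :=
  forall z : R[i], root (map_poly (real_complex R) q) z -> complex.Im z = 0.

Definition hyperbolic (d : nat) p e : Prop :=
  [/\ p \is d.-homog, 0 < p.@[e 0] &
      forall x, real_rooted (line_poly p x (- e))].

(* For [p] hyperbolic along [e] all the roots of t |-> p (t e - x) are real, so
   it suffices to quantify over (resp. count) the real ones below. *)
Definition hyperbolicity_cone p e : set 'rV[R]_N :=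
  [set x | forall t : R, root (line_poly p (- x) e) t -> 0 <= t].

Definition hyp_rank p e x : nat :=
  let q := line_poly p (- x) e in
  (\sum_(t <- rootsR q | t != 0%R) mup t q)%N.

Definition rog_hyperbolicity_cone p e : Prop :=
  pointed (hyperbolicity_cone p e) /\
  forall F, extreme_ray (hyperbolicity_cone p e) F ->
    exists2 x, F = ray x & hyp_rank p e x = 1%N.

End Hyperbolicity.

Section Spectrahedra.
Context {R : realType}.

Definition psd {m : nat} (M : 'M[R]_m) : Prop :=
  M^T = M /\ forall v : 'rV[R]_m, 0 <= (v *m M *m v^T) 0 0.

Definition spectrahedral_representation {N m : nat} (K : set 'rV[R]_N)
    (A : {linear 'rV[R]_N -> 'M[R]_m}) : Prop :=
  (forall x, (A x)^T = A x) /\ K = [set x | psd (A x)].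

Definition rog_representation {N m : nat} (K : set 'rV[R]_N)
    (A : {linear 'rV[R]_N -> 'M[R]_m}) : Prop :=
  forall x, generates_extreme_ray K x -> \rank (A x) = 1%N.

End Spectrahedra.

Definition second_order_cone (R : realType) (n : nat) : set 'rV[R]_n.+1 :=
  [set x | 0 <= x 0 ord0 /\
           \sum_(i < n) x 0 (lift ord0 i) ^+ 2 <= x 0 ord0 ^+ 2].

Arguments second_order_cone R n : clear implicits.

(* Main.v *)
Require Import Defs.
From mathcomp Require Import all_boot all_order all_algebra.
From mathcomp Require Import boolp classical_sets reals.
From mathcomp Require Import mpoly.
From mathcomp Require Import complex polyrcf ring lra.

(** Write x = (x0, x') and r = |x'|.

    The cone is the hyperbolicity cone of the Lorentz form x0^2 - |x'|^2 along
    the time axis e: the roots of t |-> p (t e - x) are x0 - r and x0 + r, both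
    real, and the smaller one is nonnegative exactly on the cone
    ([lorentz_hyperbolicity_cone]).  On an extreme ray r = x0, because a point
    with r < x0 is the midpoint of a segment of the cone in a spatial direction
    ([extreme_ray_on_boundary]); there the roots are 0 and 2 x0 > 0, so the rank
    is 1 ([lorentz_rank_boundary]).

    For a ROG spectrahedral representation A, every lightlike vector, that is,
    one with x0 = 1 = r, generates an extreme ray
    ([light_generates_extreme_ray]) and so is sent to an outer product w^T w.
    Let f_0, f_1, f_2 be three spatial axes, A (e + f_0) = u^T u and
    A (e - f_0) = v^T v.  Since (e + f_k) + (e - f_k) does not depend on k, the
    vector w attached to any e + f_k satisfies w^T w <= u^T u + v^T v in the
    semidefinite order, hence lies in the span of u and v ([outer_sub_span]).
    All four matrices A (e + f_0), A (e - f_0), A (e + f_1), A (e + f_2)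
    therefore lie in the span of u^T u, u^T v + v^T u and v^T v, which has
    dimension at most 3, whereas the four vectors are linearly independent and
    A is injective because the cone is pointed.  This is where n >= 3 enters. *)

Set Implicit Arguments.
Unset Strict Implicit.
Unset Printing Implicit Defensive.

Import Order.TTheory GRing.Theory Num.Theory.
Local Open Scope classical_set_scope.
Local Open Scope ring_scope.

(** * Spatial inner product and the extreme rays of the second-order cone *)

Section SpatialProduct.
Context {R : realType} {n : nat}.
Implicit Types (x y z : 'rV[R]_n.+1) (a : R) (i j : 'I_n).

Definition spatial_dot x y : R :=
  \sum_(i < n) x 0 (lift ord0 i) * y 0 (lift ord0 i).

Lemma spatial_dotC x y : spatial_dot x y = spatial_dot y x.
Proof. by apply: eq_bigr => i _; rewrite mulrC. Qed.

Lemma spatial_dotDl x y z :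
  spatial_dot (x + y) z = spatial_dot x z + spatial_dot y z.
Proof. by rewrite -big_split; apply: eq_bigr => i _; rewrite !mxE mulrDl. Qed.

Lemma spatial_dotZl a x y : spatial_dot (a *: x) y = a * spatial_dot x y.
Proof. by rewrite mulr_sumr; apply: eq_bigr => i _; rewrite !mxE mulrA. Qed.

Lemma spatial_dotDr x y z :
  spatial_dot x (y + z) = spatial_dot x y + spatial_dot x z.
Proof. by rewrite !(spatial_dotC x) spatial_dotDl. Qed.

Lemma spatial_dotZr a x y : spatial_dot x (a *: y) = a * spatial_dot x y.
Proof. by rewrite !(spatial_dotC x) spatial_dotZl. Qed.

Lemma spatial_dotNl x y : spatial_dot (- x) y = - spatial_dot x y.
Proof. by rewrite -scaleN1r spatial_dotZl mulN1r. Qed.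

Lemma spatial_dotNr x y : spatial_dot x (- y) = - spatial_dot x y.
Proof. by rewrite !(spatial_dotC x) spatial_dotNl. Qed.

Lemma spatial_dot0r x : spatial_dot x 0 = 0.
Proof. by rewrite -(scale0r 0) spatial_dotZr mul0r. Qed.

Lemma spatial_dot_ge0 x : 0 <= spatial_dot x x.
Proof. by apply: sumr_ge0 => i _; rewrite -expr2 sqr_ge0. Qed.

Lemma spatial_dot_eq0 x :
  x 0 ord0 = 0 -> spatial_dot x x = 0 -> x = 0.
Proof.
move=> x00 /eqP; rewrite psumr_eq0; last by move=> i _; rewrite -expr2 sqr_ge0.
move=> /allP xi0; apply/rowP => j; rewrite mxE.
case: (unliftP ord0 j) => [i ->|-> //].
by have := xi0 i (mem_index_enum i); rewrite -expr2 sqrf_eq0 => /eqP.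
Qed.

Lemma sqr_coord_le_spatial_dot x i :
  x 0 (lift ord0 i) ^+ 2 <= spatial_dot x x.
Proof.
rewrite /spatial_dot (bigD1 i) //= -expr2 lerDl.
by apply: sumr_ge0 => j _; rewrite -expr2 sqr_ge0.
Qed.

Definition time_axis : 'rV[R]_n.+1 := delta_mx 0 ord0.
Definition space_axis i : 'rV[R]_n.+1 := delta_mx 0 (lift ord0 i).

Lemma time_axis0 : time_axis 0 ord0 = 1.
Proof. by rewrite mxE !eqxx. Qed.

Lemma time_axisS i : time_axis 0 (lift ord0 i) = 0.
Proof. by rewrite mxE eqxx eq_sym (negPf (neq_lift _ _)). Qed.

Lemma space_axis0 i : space_axis i 0 ord0 = 0.
Proof. by rewrite mxE. Qed.

Lemma space_axisS i j : space_axis i 0 (lift ord0 j) = (j == i)%:R.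
Proof. by rewrite mxE eqxx (inj_eq lift_inj). Qed.

Lemma spatial_dot_time x : spatial_dot time_axis x = 0.
Proof. by apply: big1 => i _; rewrite time_axisS mul0r. Qed.

Lemma spatial_dot_axis i x : spatial_dot (space_axis i) x = x 0 (lift ord0 i).
Proof.
rewrite /spatial_dot (bigD1 i) //= space_axisS eqxx mul1r big1 ?addr0 //.
by move=> j /negPf ji; rewrite space_axisS ji mul0r.
Qed.

Lemma light_axis (s : R) i : s ^+ 2 = 1 ->
  (time_axis + s *: space_axis i) 0 ord0 = 1 /\
  spatial_dot (time_axis + s *: space_axis i) (time_axis + s *: space_axis i) = 1.
Proof.
move=> s2; rewrite !mxE eqxx mulr0 addr0; split=> //.
rewrite spatial_dotDl spatial_dot_time add0r spatial_dotZl spatial_dot_axis.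
by rewrite mxE [X in _ + X]mxE time_axisS space_axisS eqxx mulr1 add0r -expr2.
Qed.

Lemma second_order_coneE x :
  second_order_cone R n x <->
  0 <= x 0 ord0 /\ spatial_dot x x <= x 0 ord0 ^+ 2.
Proof.
suff -> : spatial_dot x x = \sum_(i < n) x 0 (lift ord0 i) ^+ 2 by [].
by apply: eq_bigr => i _; rewrite expr2.
Qed.

Lemma cone_time0 x : second_order_cone R n x -> x 0 ord0 = 0 -> x = 0.
Proof.
move=> /second_order_coneE[_] + x0; rewrite x0 expr0n /= => xx.
by apply: spatial_dot_eq0 => //; apply/eqP; rewrite eq_le xx spatial_dot_ge0.
Qed.

Lemma second_order_cone_pointed : pointed (second_order_cone R n).
Proof.
apply/seteqP; split=> [x [Kx KNx]|x /= ->] /=.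
  apply: cone_time0 => //.
  have /second_order_coneE[+ _] := Kx; have /second_order_coneE[+ _] := KNx.
  by rewrite mxE; lra.
have K0 : second_order_cone R n 0.
  apply/second_order_coneE; rewrite mxE lexx; split=> //.
  by rewrite -(scale0r 0) spatial_dotZl mul0r expr0n.
by split=> //=; rewrite oppr0.
Qed.

(** This is the equality case of Cauchy-Schwarz.  For w in the cone the gap
    w0 - <w', x'> bounds the squared distance from w' to w0 x'; it is nonnegative, and
    it is additive in w and vanishes on the multiples of x, so it vanishes on
    both summands. *)
Lemma light_ray_absorbs x y z a :
    x 0 ord0 = 1 -> spatial_dot x x = 1 ->
    second_order_cone R n y -> second_order_cone R n z -> y + z = a *: x ->
  y = y 0 ord0 *: x.
Proof.
move=> x0 xx Ky Kz yza.
pose gap (w : 'rV[R]_n.+1) := w 0 ord0 - spatial_dot w x.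
(* expand |w' - w0 x'|^2 and use |w'|^2 <= w0^2 *)
have gapP w : second_order_cone R n w ->
    0 <= spatial_dot (w - w 0 ord0 *: x) (w - w 0 ord0 *: x)
      <= 2 * w 0 ord0 * gap w.
  move=> /second_order_coneE[w0 ww]; rewrite spatial_dot_ge0 /=.
  rewrite !(spatial_dotDl, spatial_dotDr, spatial_dotNl, spatial_dotNr).
  rewrite !(spatial_dotZl, spatial_dotZr) xx (spatial_dotC x w) /gap.
  set s := spatial_dot w w in ww *; set t := spatial_dot w x; nra.
have gap_ge0 w : second_order_cone R n w -> 0 <= gap w.
  move=> Kw; have /second_order_coneE[+ _] := Kw.
  rewrite le_eqVlt => /orP[/eqP w0|w0].
    by rewrite (cone_time0 Kw) // /gap mxE -(scale0r 0) spatial_dotZl; lra.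
  have /andP[/le_trans/[apply]] := gapP w Kw.
  by rewrite pmulr_rge0 ?mulr_gt0.
have gap0 : gap y = 0.
  have : gap y + gap z = 0.
    have -> : gap y + gap z = (y + z) 0 ord0 - spatial_dot (y + z) x.
      by rewrite spatial_dotDl mxE /gap; ring.
    by rewrite yza spatial_dotZl xx mxE x0; ring.
  by have := gap_ge0 y Ky; have := gap_ge0 z Kz; lra.
apply/eqP; rewrite -subr_eq0; apply/eqP; apply: spatial_dot_eq0.
  by rewrite !mxE x0; ring.
by have := gapP y Ky; rewrite gap0 mulr0 -eq_le eq_sym => /eqP.
Qed.

Lemma light_generates_extreme_ray x :
    x 0 ord0 = 1 -> spatial_dot x x = 1 ->
  generates_extreme_ray (second_order_cone R n) x.
Proof.
move=> x0 xx.
have time_ge0 y : second_order_cone R n y -> 0 <= y 0 ord0.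
  by move=> /second_order_coneE[].
split; first split.
- by exists 0, 0; rewrite ?scale0r.
- move=> _ [a a0 ->]; apply/second_order_coneE; rewrite mxE x0 mulr1.
  by rewrite spatial_dotZl spatial_dotZr xx mulr1 expr2.
- split=> [_ _ [a a0 ->] [b b0 ->]|a _ a0 [b b0 ->]].
    by exists (a + b); rewrite ?addr_ge0 ?scalerDl.
  by exists (a * b); rewrite ?mulr_ge0 ?scalerA.
- move=> y z Ky Kz [a _ yza]; split.
    by exists (y 0 ord0); [exact: time_ge0|exact: light_ray_absorbs yza].
  exists (z 0 ord0); first exact: time_ge0.
  by rewrite addrC in yza; exact: light_ray_absorbs yza.
exists <[x]>%VS.
  split=> [_ [a _ ->]|W rayW] /=; first exact: memvZ (memv_line x).
  by rewrite -memvE; apply: rayW; exists 1; rewrite ?scale1r.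
rewrite dim_vline; suff -> : x != 0 by [].
by apply/eqP => /rowP/(_ ord0); rewrite x0 mxE; lra.
Qed.

(** Halves, because a face sees a point only as a sum of two cone elements. *)
Lemma interior_perturbation x i :
    0 <= x 0 ord0 -> spatial_dot x x < x 0 ord0 ^+ 2 ->
  exists2 d : R, d != 0 &
    second_order_cone R n (2^-1 *: x + d *: space_axis i) /\
    second_order_cone R n (2^-1 *: x - d *: space_axis i).
Proof.
move=> x_ge0 xx.
pose r := Num.sqrt (spatial_dot x x).
have r2 : r ^+ 2 = spatial_dot x x by rewrite sqr_sqrtr // spatial_dot_ge0.
have r_ge0 : 0 <= r by rewrite sqrtr_ge0.
have rx : r < x 0 ord0 by rewrite -ltr_sqr ?nnegrE ?r2.
have : `|x 0 (lift ord0 i)| <= r.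
  by rewrite -sqrtr_sqr ler_wsqrtr // sqr_coord_le_spatial_dot.
rewrite ler_norml => /andP[xi_ge xi_le].
(* with this step the perturbed spatial part has length at most x0 / 2 *)
exists ((x 0 ord0 - r) / 2); first by rewrite gt_eqF // divr_gt0 ?subr_gt0.
have gap_up : 0 <= (x 0 ord0 - r) * (r - x 0 (lift ord0 i)).
  by rewrite mulr_ge0 // subr_ge0 // ltW.
have gap_down : 0 <= (x 0 ord0 - r) * (r + x 0 (lift ord0 i)).
  by rewrite mulr_ge0 ?subr_ge0 ?(ltW rx) // -lerBlDl sub0r.
split; apply/second_order_coneE; rewrite !mxE /=;
  rewrite !(spatial_dotDl, spatial_dotDr, spatial_dotNl, spatial_dotNr);
  rewrite !(spatial_dotZl, spatial_dotZr) !(spatial_dotC x (space_axis i));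
  rewrite !spatial_dot_axis space_axisS eqxx -r2 mulr1n; split; lra.
Qed.

(** Off the boundary, [interior_perturbation] would put a spatial axis in the
    line spanned by the face, but that line contains a vector with positive time
    coordinate. *)
Lemma extreme_ray_on_boundary F :
    (0 < n)%N -> extreme_ray (second_order_cone R n) F ->
  exists x, [/\ F = ray x, 0 < x 0 ord0 & spatial_dot x x = x 0 ord0 ^+ 2].
Proof.
move=> n0 [[_ FK [FD FZ] Fface] [U [FU Umin] dimU]].
have [x Fx x_neq0] : exists2 x, F x & x != 0.
  apply: contrapT => noF; suff : (U <= 0)%VS by move=> /dimvS; rewrite dimU dimv0.
  apply: Umin => y Fy /=; rewrite memv0; apply: contrapT => /negP y0.
  by apply: noF; exists y.
have [x_ge0 xx] := (second_order_coneE x).1 (FK _ Fx).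
have x_gt0 : 0 < x 0 ord0.
  rewrite lt_def x_ge0 andbT; apply: contra x_neq0 => /eqP x0.
  by rewrite (cone_time0 (FK _ Fx)).
have Ux : U = <[x]>%VS.
  apply/eqP; rewrite eq_sym eqEdim -memvE dimU dim_vline x_neq0 andbT.
  exact: FU.
exists x; split=> //.
  apply/seteqP; split=> [y Fy|_ [a a0 ->]]; last exact: FZ.
  have /vlineP[a ya] : y \in <[x]>%VS by rewrite -Ux; apply: FU.
  exists a => //; have /second_order_coneE[+ _] := FK _ Fy.
  by rewrite ya mxE pmulr_lge0.
apply/eqP; rewrite eq_le xx leNgt; apply/negP => xlt.
have axisU i : space_axis i \in U.
  have [d d0 [Kp Km]] := interior_perturbation i x_ge0 xlt.
  have half : 2^-1 *: x + 2^-1 *: x = x.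
    by rewrite -scalerDl -[RHS]scale1r; congr (_ *: _); lra.
  have [/FU/= Up _] : F (2^-1 *: x + d *: space_axis i)
      /\ F (2^-1 *: x - d *: space_axis i).
    by apply: Fface => //; rewrite addrACA subrr addr0 half.
  have Uhx : 2^-1 *: x \in U by apply: memvZ; exact: FU.
  by move: Up; rewrite rpredDl // rpredZeq (negPf d0).
(* the time coordinate tells a spatial axis from a multiple of x *)
have /vlineP[a axis_ax] : space_axis (Ordinal n0) \in <[x]>%VS by rewrite -Ux.
have a0 : a = 0.
  have /rowP/(_ ord0) := axis_ax; rewrite space_axis0 mxE => /esym/eqP.
  by rewrite mulf_eq0 (gt_eqF x_gt0) orbF => /eqP.
have /rowP/(_ (lift ord0 (Ordinal n0))) := axis_ax.
by rewrite a0 scale0r space_axisS eqxx mxE => /eqP; rewrite oner_eq0.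
Qed.

End SpatialProduct.

(** * The Lorentz form and its hyperbolicity cone *)

Section LorentzPolynomial.
Context {R : realType} {n : nat}.
Implicit Types x : 'rV[R]_n.+1.

Definition lorentz_poly : {mpoly R[n.+1]} :=
  'X_ord0 ^+ 2 - \sum_(i < n) 'X_(lift ord0 i) ^+ 2.

Lemma lorentz_poly_homog : lorentz_poly \is 2.-homog.
Proof.
have sqrX_homog (i : 'I_n.+1) : ('X_i : {mpoly R[n.+1]}) ^+ 2 \is 2.-homog.
  by rewrite mpolyXn dhomogX /= mdegMn mdeg1.
by rewrite rpredB // rpred_sum.
Qed.

Lemma line_poly_lorentz x (y : 'rV[R]_n.+1) :
  line_poly lorentz_poly x y =
  ((x 0 ord0)%:P + y 0 ord0 *: 'X) ^+ 2
  - \sum_(i < n) ((x 0 (lift ord0 i))%:P + y 0 (lift ord0 i) *: 'X) ^+ 2.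
Proof.
rewrite /line_poly /lorentz_poly rmorphB rmorph_sum /= rmorphXn /= mmapX mmap1U.
by congr (_ - _); apply: eq_bigr => i _; rewrite rmorphXn /= mmapX mmap1U.
Qed.

Definition char_roots x : seq R :=
  [:: x 0 ord0 - Num.sqrt (spatial_dot x x);
      x 0 ord0 + Num.sqrt (spatial_dot x x)].

Lemma line_poly_char_roots x :
  line_poly lorentz_poly (- x) time_axis = \prod_(c <- char_roots x) ('X - c%:P).
Proof.
rewrite line_poly_lorentz !big_cons big_nil mulr1 time_axis0 scale1r mxE.
under eq_bigr => i _ do
  rewrite time_axisS scale0r addr0 mxE -polyC_exp expr2 mulrNN.
rewrite -rmorph_sum /= -/(spatial_dot x x) -[in LHS](sqr_sqrtr (spatial_dot_ge0 x)).
rewrite polyC_exp !rmorphD !rmorphN /=; ring.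
Qed.

(** The form is even, so p (x - t e) = p (t e - x); hyperbolicity is phrased with
    the former, the cone and the rank with the latter. *)
Lemma line_poly_char_roots_rev x :
  line_poly lorentz_poly x (- time_axis) = \prod_(c <- char_roots x) ('X - c%:P).
Proof.
rewrite -line_poly_char_roots !line_poly_lorentz.
congr (_ - _); last apply: eq_bigr => i _; rewrite !mxE polyCN scaleNr; ring.
Qed.

Lemma root_char_roots x (t : R) :
  root (line_poly lorentz_poly (- x) time_axis) t = (t \in char_roots x).
Proof. by rewrite line_poly_char_roots root_prod_XsubC. Qed.

Lemma lorentz_poly_hyperbolic : hyperbolic 2 lorentz_poly time_axis.
Proof.
split; first exact: lorentz_poly_homog.
  rewrite rmorphB rmorphXn rmorph_sum /= mevalXU time_axis0 expr1n.
  rewrite big1 ?subr0 // => i _.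
  by rewrite rmorphXn /= mevalXU time_axisS expr0n.
move=> x z; rewrite line_poly_char_roots_rev rmorph_prod /=.
under eq_bigr => c _ do rewrite map_polyXsubC.
rewrite -(big_map (real_complex R) predT (fun c => 'X - c%:P)) root_prod_XsubC.
by move=> /mapP[c _ ->].
Qed.

Lemma lorentz_hyperbolicity_cone :
  second_order_cone R n = hyperbolicity_cone lorentz_poly time_axis.
Proof.
apply/seteqP; split=> x.
  move=> /second_order_coneE[x0 xx] t.
  have : Num.sqrt (spatial_dot x x) <= x 0 ord0.
    by rewrite -[leRHS]ger0_norm // -sqrtr_sqr ler_wsqrtr.
  have := sqrtr_ge0 (spatial_dot x x).
  by rewrite root_char_roots !inE => ? ? /orP[] /eqP ->; lra.
move=> roots_ge0; apply/second_order_coneE.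
have := roots_ge0 (x 0 ord0 - Num.sqrt (spatial_dot x x)).
rewrite root_char_roots mem_head => /(_ isT); rewrite subr_ge0 => r_le.
have x0 := le_trans (sqrtr_ge0 _) r_le; split=> //.
by rewrite -(sqr_sqrtr (spatial_dot_ge0 x)) ler_sqr ?nnegrE ?sqrtr_ge0.
Qed.

Lemma lorentz_rank_boundary x :
    0 < x 0 ord0 -> spatial_dot x x = x 0 ord0 ^+ 2 ->
  hyp_rank lorentz_poly time_axis x = 1%N.
Proof.
move=> x0 xx; rewrite /hyp_rank line_poly_char_roots /char_roots xx.
rewrite sqrtr_sqr gtr0_norm // subrr.
set b := x 0 ord0 + x 0 ord0; have b0 : b != 0 by rewrite gt_eqF ?addr_gt0.
set q := \prod_(c <- _) _.
have q0 : q != 0 by rewrite monic_neq0 // monic_prod_XsubC.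
have roots_q : perm_eq (rootsR q) [:: 0; b].
  apply: uniq_perm; first exact: uniq_roots.
    by rewrite /= inE eq_sym b0.
  by move=> t; rewrite -(roots_on_rootsR q0) in_itv /= root_prod_XsubC.
rewrite (perm_big _ roots_q) /= big_cons eqxx /= big_cons b0 big_nil addn0.
by rewrite mu_prod_XsubC /= eqxx eq_sym (negPf b0).
Qed.

End LorentzPolynomial.

(** * Positive semidefinite matrices of rank one *)

Section RankOnePsd.
Context {R : realType} {m : nat}.
Implicit Types (M P Q : 'M[R]_m) (u v w : 'rV[R]_m).

Definition qform M v : R := (v *m M *m v^T) 0 0.

Lemma qform_outer u v : qform (u^T *m u) v = (v *m u^T) 0 0 ^+ 2.
Proof.
have uv : u *m v^T = (v *m u^T)^T by rewrite trmx_mul trmxK.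
by rewrite /qform mulmxA -(mulmxA (v *m u^T)) uv [LHS]mxE big_ord1 [_^T _ _]mxE.
Qed.

Lemma qformD P Q v : qform (P + Q) v = qform P v + qform Q v.
Proof. by rewrite /qform mulmxDr mulmxDl mxE. Qed.

(** A rank factorization M = c r of a symmetric matrix has c proportional to r^T;
    a positive diagonal entry of r^T r shows that the factor is nonnegative, so
    that its square root can be absorbed in r. *)
Lemma psd_rank1 M : psd M -> \rank M = 1%N -> exists u, M = u^T *m u.
Proof.
move=> [Msym Mpos] rkM.
have [c [r Mcr]] : exists (c : 'cV[R]_m) (r : 'rV[R]_m), M = c *m r.
  move: (\rank M) rkM (col_base M) (row_base M) (mulmx_base M) => _ -> c r <-.
  by exists c, r.
have r0 : r != 0.
  by apply/eqP => r0; move: rkM; rewrite Mcr r0 mulmx0 mxrank0.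
have [j rj] : exists j, r 0 j != 0.
  apply: contrapT => noj; case/eqP: r0; apply/rowP => j; rewrite mxE.
  by apply: contrapT => /eqP rj; apply: noj; exists j.
have ME i k : M i k = c i 0 * r 0 k by rewrite Mcr mxE big_ord1.
pose l := c j 0 / r 0 j.
have cE i : c i 0 = l * r 0 i.
  have : M i j = M j i by rewrite -[in LHS]Msym mxE.
  by rewrite !ME /l => cr; apply: (mulIf rj); rewrite cr; field.
have l0 : 0 <= l.
  have := Mpos (delta_mx 0 j).
  rewrite -rowE trmx_delta -colE !mxE ME cE -mulrA -expr2 pmulr_lge0 //.
  by rewrite exprn_even_gt0.
exists (Num.sqrt l *: r); rewrite !linearZ /= -scalemxAl scalerA.
rewrite -expr2 sqr_sqrtr //; apply/matrixP => i k.
by rewrite ME cE !mxE big_ord1 mxE mulrA.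
Qed.

(** A vector z orthogonal to u and v kills the quadratic form of the right-hand
    side; the left-hand side is a sum of nonnegative forms, so z is orthogonal to
    w too.  Hence w is in the double orthogonal of u and v. *)
Lemma outer_sub_span u v w N :
    psd N -> w^T *m w + N = u^T *m u + v^T *m v ->
  exists a b, w = a *: u + b *: v.
Proof.
move=> [_ Npos] wN.
have /submxP[D ->] : (w <= col_mx u v)%MS.
  rewrite submxE; apply/eqP; apply/rowP => j; rewrite [RHS]mxE.
  set C := cokermx _; pose z := (col j C)^T.
  (* the columns of C span the orthogonal of u and v *)
  have dot0 (y : 'rV[R]_m) : (y *m C) 0 j = (z *m y^T) 0 0.
    rewrite -trmx_mul [RHS]mxE [LHS]mxE [RHS]mxE.
    by apply: eq_bigr => i _; rewrite [col _ _ _ _]mxE.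
  have : col_mx u v *m C = 0 by exact: mulmx_coker.
  rewrite mul_col_mx -[0]vsubmxK => /eq_col_mx[uC vC].
  have := Npos z; rewrite -/(qform N z) => Nz.
  have /(congr1 (qform^~ z)) := wN; rewrite !qformD !qform_outer -!dot0 uC vC.
  rewrite !mxE expr0n addr0 => /eqP; rewrite paddr_eq0 ?sqr_ge0 //.
  by rewrite sqrf_eq0 => /andP[/eqP].
exists (lsubmx D 0 0), (rsubmx D 0 0).
rewrite -{1}[D]hsubmxK mul_row_col.
by congr (_ + _); rewrite [X in X *m _]mx11_scalar mul_scalar_mx.
Qed.

End RankOnePsd.

(** * Spectrahedral representations of the second-order cone *)

Section NoRogRepresentation.
Context {R : realType} {n m : nat} {A : {linear 'rV[R]_n.+1 -> 'M[R]_m}}.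

(** If A x = 0, both x and - x are sent to a semidefinite matrix. *)
Lemma pointed_representation_inj (K : set 'rV[R]_n.+1) (x : 'rV[R]_n.+1) :
  pointed K -> spectrahedral_representation K A -> A x = 0 -> x = 0.
Proof.
move=> pK [_ KA] Ax.
have psd0 : psd (0 : 'M[R]_m).
  by split=> [|v]; rewrite ?trmx0 // mulmx0 mul0mx mxE.
have /seteqP[/(_ x) + _] := pK; apply.
by rewrite KA; split=> /=; rewrite ?linearN /= Ax ?oppr0.
Qed.

Lemma no_rog_representation :
    (3 <= n)%N -> spectrahedral_representation (second_order_cone R n) A ->
  ~ rog_representation (second_order_cone R n) A.
Proof.
move=> n3 repA rogA.
have Ainj := pointed_representation_inj second_order_cone_pointed repA.
pose f (k : 'I_3) : 'rV[R]_n.+1 := space_axis (widen_ord n3 k).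
have outer (x : 'rV[R]_n.+1) : x 0 ord0 = 1 -> spatial_dot x x = 1 ->
    exists u : 'rV[R]_m, A x = u^T *m u.
  move=> x0 xx; have xgen := light_generates_extreme_ray x0 xx.
  apply: psd_rank1 (rogA _ xgen).
  have [[_ Fsub _ _] _] := xgen; have : ray x x by exists 1; rewrite ?scale1r.
  by move=> /Fsub; rewrite {1}repA.2.
pose light (c : R) k := time_axis + c *: f k.
have light_outer (s : R) k : s ^+ 2 = 1 ->
    exists w : 'rV[R]_m, A (light s k) = w^T *m w.
  by move=> s2; have [? ?] := light_axis (widen_ord n3 k) s2; exact: outer.
have one2 : 1 ^+ 2 = 1 :> R by rewrite expr1n.
have mone2 : (-1) ^+ 2 = 1 :> R by rewrite sqrrN expr1n.
have [u Au] := light_outer 1 0 one2; have [v Av] := light_outer (-1) 0 mone2.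
have span k : exists a b, A (light 1 k) =
    a ^+ 2 *: (u^T *m u) + (a * b) *: (u^T *m v + v^T *m u)
    + b ^+ 2 *: (v^T *m v).
  have [w Aw] := light_outer 1 k one2; have [w' Aw'] := light_outer (-1) k mone2.
  have [a [b wab]] : exists a b, w = a *: u + b *: v.
    apply: (@outer_sub_span _ _ u v w (w'^T *m w')).
      split=> [|z]; first by rewrite trmx_mul trmxK.
      by rewrite -/(qform _ z) qform_outer sqr_ge0.
    rewrite -Au -Av -Aw -Aw' -!linearD; congr (A _).
    by rewrite /light !scaleN1r !scale1r !(addrACA _ _ time_axis) !subrr.
  exists a, b; rewrite Aw wab; apply/matrixP => i j.
  by rewrite !(mxE, big_ord1); ring.
have [a1 [b1 A1]] := span 1; have [a2 [b2 A2]] := span 2.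
(* The coefficients a2 b2 and a1 b1 cancel the mixed matrix u^T v + v^T u; the
   remaining multiples of u^T u and v^T v are images of e + f_0 and e - f_0. *)
have dep : (a2 * b2) *: light 1 1 - (a1 * b1) *: light 1 2
    - (a2 * b2 * a1 ^+ 2 - a1 * b1 * a2 ^+ 2) *: light 1 0
    - (a2 * b2 * b1 ^+ 2 - a1 * b1 * b2 ^+ 2) *: light (-1) 0 = 0.
  apply: Ainj; rewrite !linearB !linearZ /= Au Av A1 A2.
  by apply/matrixP => i j; rewrite !mxE; ring.
have dot_time k : spatial_dot (f k) time_axis = 0.
  by rewrite spatial_dotC spatial_dot_time.
have dot_f k l : spatial_dot (f k) (f l) = (k == l)%:R.
  by rewrite spatial_dot_axis space_axisS.
(* Only e + f_1 has a component along f_1. *)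
have ab2 : a2 * b2 = 0.
  have /(congr1 (spatial_dot (f 1))) := dep.
  rewrite !(spatial_dotDr, spatial_dotNr, spatial_dotZr) !dot_time !dot_f.
  by rewrite spatial_dot0r /=; lra.
(* Without its mixed term, the image of e + f_2 is spanned by u^T u and v^T v. *)
have dep2 : light 1 2 - a2 ^+ 2 *: light 1 0 - b2 ^+ 2 *: light (-1) 0 = 0.
  apply: Ainj; rewrite !linearB !linearZ /= Au Av A2 ab2.
  by apply/matrixP => i j; rewrite !mxE; ring.
have /(congr1 (spatial_dot (f 2))) := dep2.
rewrite !(spatial_dotDr, spatial_dotNr, spatial_dotZr) !dot_time !dot_f.
by rewrite spatial_dot0r /=; lra.
Qed.

End NoRogRepresentation.

Theorem proposition3p12 (R : realType) (n : nat) (hn : (3 <= n)%N) :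
  (exists (d : nat) (p : {mpoly R[n.+1]}) (e : 'rV[R]_n.+1),
     [/\ hyperbolic d p e,
         second_order_cone R n = hyperbolicity_cone p e &
         rog_hyperbolicity_cone p e])
  /\
  (forall (m : nat) (A : {linear 'rV[R]_n.+1 -> 'M[R]_m}),
     spectrahedral_representation (second_order_cone R n) A ->
     ~ rog_representation (second_order_cone R n) A).
Proof.
split; last by move=> m A; exact: no_rog_representation.
exists 2, lorentz_poly, time_axis; split.
- exact: lorentz_poly_hyperbolic.
- exact: lorentz_hyperbolicity_cone.
rewrite /rog_hyperbolicity_cone -lorentz_hyperbolicity_cone.
split=> [|F extF]; first exact: second_order_cone_pointed.
have [x [-> x0 xx]] := extreme_ray_on_boundary (leq_trans (ltn0Sn 2) hn) extF.
by exists x => //; exact: lorentz_rank_boundary.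
Qed.
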